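(* Let $n$ be a natural number with exactly $k$ decimal digits such that $10\nmid n$ and $n\ne r(n)$. Then there exists a natural number $\omega>0$ such that for every integer $c\ge 1$, $n\rho_{c,k}$ is $v$-palindromic if and only if $n\rho_{c+\omega,k}$ is $v$-palindromic. In other words, whether $n\rho_{c,k}$ is $v$-palindromic depends only on $c$ modulo $\omega$.
   Context: Natural numbers are positive integers. For a natural number $n$ with $10\nmid n$ and decimal representation $n=d_{k-1}\ldots d_1d_0$, $r(n)=d_0d_1\ldots d_{k-1}$ denotes the number obtained by writing the decimal digits of $n$ in reverse order. The function $v:\mathbb{N}\to\mathbb{Z}_{\ge 0}$ is the additive arithmetic function (that is, $v(ab)=v(a)+v(b)$ whenever $\gcd(a,b)=1$; in particular $v(1)=0$) determined on prime powers by $v(p)=p$ and $v(p^e)=p+e$ for $e\ge 2$, where $p$ is a prime. A natural number $n$ is called $v$-palindromic if $10\nmid n$, $n\ne r(n)$, and $v(n)=v(r(n))$. For integers $c,k\ge 1$, $\rho_{c,k}=\sum_{i=0}^{c-1}10^{ki}$, i.e. the number whose decimal representation has the digit $1$ appearing $c$ times with exactly $k-1$ zeros between each consecutive pair of $1$'s (starting and ending with $1$). Thus if $n$ has $k$ digits, $n\rho_{c,k}$ is the number formed by repeating the decimal digits of $n$ $c$ times. *)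

(* Defs.v *)
From mathcomp Require Import all_boot.

Set Implicit Arguments.
Unset Strict Implicit.
Unset Printing Implicit Defensive.

(* Least significant digit first.  For n > 0 the number of digits is
   (trunc_log 10 n).+1, since 10 ^ trunc_log 10 n <= n < 10 ^ (trunc_log 10 n).+1. *)
Definition digits (n : nat) : seq nat :=
  mkseq (fun i => n %/ 10 ^ i %% 10) (trunc_log 10 n).+1.

Definition of_digits (s : seq nat) : nat :=
  \sum_(i < size s) nth 0 s i * 10 ^ i.

Definition digit_rev (n : nat) : nat := of_digits (rev (digits n)).

(* The additive function with v(p) = p and v(p^e) = p + e for e >= 2; see
   v_coprime, v_prime and v_primeX. *)
Definition v (n : nat) : nat :=
  \sum_(p <- primes n) (if logn p n == 1 then p else p + logn p n).

Definition v_palindromic (n : nat) : bool :=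
  [&& 0 < n, ~~ (10 %| n), n != digit_rev n & v n == v (digit_rev n)].

Definition rho (c k : nat) : nat := \sum_(0 <= i < c) 10 ^ (k * i).

Lemma digitsK n : of_digits (digits n) = n.
Proof.
rewrite /of_digits size_mkseq.
under eq_bigr => i _ do rewrite nth_mkseq //.
have divE m : n = \sum_(i < m) n %/ 10 ^ i %% 10 * 10 ^ i + n %/ 10 ^ m * 10 ^ m.
  elim: m => [|m IH]; first by rewrite big_ord0 divn1 muln1.
  rewrite big_ord_recr /= {1}IH -addnA; congr (_ + _).
  by rewrite [in LHS](divn_eq (n %/ 10 ^ m) 10) mulnDl addnC -divnMA -expnSr
    -mulnA -expnS.
rewrite [RHS](divE (trunc_log 10 n).+1) [n %/ _ in RHS]divn_small ?addn0 //.
exact: trunc_log_ltn.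
Qed.

Lemma size_digits n k : 0 < n ->
  size (digits n) = k.+1 <-> 10 ^ k <= n < 10 ^ k.+1.
Proof.
move=> n_gt0; rewrite size_mkseq; split=> [[<-]|/andP[le_kn lt_nk]].
  exact: trunc_log_bounds.
by congr _.+1; apply: trunc_log_eq; rewrite ?le_kn.
Qed.

Lemma v_coprime a b : 0 < a -> 0 < b -> coprime a b -> v (a * b) = v a + v b.
Proof.
move=> a_gt0 b_gt0 co_ab.
have disj p : p \in primes a -> p \notin primes b.
  by move=> pa; have:= coprime_has_primes a_gt0 b_gt0;
     rewrite co_ab => /esym/hasPn H; apply/negP => /H /negP[].
have perm_ab : perm_eq (primes (a * b)) (primes a ++ primes b).
  apply: uniq_perm; rewrite ?cat_uniq ?primes_uniq //= ?andbT.
    by apply/hasPn => p pb; apply/negP => /disj; rewrite pb.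
  by move=> p; rewrite mem_cat primesM.
have log0 p m : p \notin primes m -> logn p m = 0.
  by rewrite -logn_gt0 -eqn0Ngt => /eqP.
rewrite /v (perm_big _ perm_ab) big_cat /=; congr (_ + _).
  by apply: eq_big_seq => p pa; rewrite lognM // (log0 _ b) ?addn0 ?disj.
apply: eq_big_seq => p pb; rewrite lognM // (log0 _ a) //.
by apply/negP => /disj; rewrite pb.
Qed.

Lemma v_prime p : prime p -> v p = p.
Proof. by move=> pr_p; rewrite /v primes_prime // big_seq1 logn_prime ?eqxx. Qed.

Lemma v_primeX p e : prime p -> 1 < e -> v (p ^ e) = p + e.
Proof.
case: e => [|[|e]] // pr_p _.
by rewrite /v primesX // primes_prime // big_seq1 pfactorK.
Qed.

(* Main.v *)
Require Import Defs.
From mathcomp Require Import all_boot.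
From mathcomp Require Import cyclic zify.

(** The repetition of the digits of [n] and its reversal have the common factor
    [rho c k]: reversing [c] copies of a block gives [c] copies of the reversed
    block, so [digit_rev (n * rho c k) = digit_rev n * rho c k] (lemma
    [digit_rev_mul_rho]).  Since [rho c k] is prime to 10, only the equation
    [v (n * rho c k) = v (m * rho c k)], with [m = digit_rev n], is left to
    compare for different [c].

    A prime dividing [rho c k] but not [n * m] contributes the same amount to
    both sides.  At one of the finitely many other primes [p], let [a], [b] and
    [e] be the exponents of [p] in [n], [m] and [rho c k]; the difference of the
    two contributions is that of [v_term p (a + e)] and [v_term p (b + e)].
    The function [v_term p] is affine of slope 1 from 2 on, so this difference
    depends only on the least of [e] and 2 ([v_term_exchange]), that is, on
    which of [p] and [p ^ 2] divide [rho c k].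

    Finally, for fixed [d], the divisibility of [rho c k] by [d] is periodic in
    [c >= 1] ([dvdn_rho_periodic]).  The product of the periods for all [p] and
    [p ^ 2] is then a possible [omega]. *)

(** * Reversing repeated blocks of digits *)

Lemma of_digits_cons x s : of_digits (x :: s) = x + 10 * of_digits s.
Proof.
rewrite /of_digits big_ord_recl /= muln1 big_distrr /=; congr (_ + _).
by apply: eq_bigr => i _; rewrite /= expnS mulnCA.
Qed.

Lemma of_digits_nil : of_digits [::] = 0.
Proof. by rewrite /of_digits big_ord0. Qed.

Lemma of_digits_cat s t :
  of_digits (s ++ t) = of_digits s + 10 ^ size s * of_digits t.
Proof.
elim: s => [|x s IHs] /=; first by rewrite of_digits_nil mul1n.
by rewrite !of_digits_cons IHs mulnDr addnA expnS mulnA.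
Qed.

Lemma rhoS c k : rho c.+1 k = 1 + 10 ^ k * rho c k.
Proof.
rewrite /rho big_nat_recl // muln0 expn0 big_distrr /=; congr (_ + _).
by apply: eq_bigr => i _; rewrite mulnS expnD.
Qed.

Lemma of_digits_repeat c s :
  of_digits (flatten (nseq c s)) = of_digits s * rho c (size s).
Proof.
elim: c => [|c IHc] /=; first by rewrite of_digits_nil /rho big_geq ?muln0.
by rewrite of_digits_cat IHc rhoS mulnDr muln1 mulnCA.
Qed.

Lemma rev_repeat (T : Type) c (s : seq T) :
  rev (flatten (nseq c s)) = flatten (nseq c (rev s)).
Proof. by rewrite rev_flatten map_nseq rev_nseq. Qed.

Lemma digits_cons x m : x < 10 -> 0 < m -> digits (x + 10 * m) = x :: digits m.
Proof.
move=> x_lt10 m_gt0; rewrite /digits.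
have -> : trunc_log 10 (x + 10 * m) = (trunc_log 10 m).+1.
  apply: trunc_log_eq => //.
  have /andP[] := @trunc_log_bounds 10 m isT m_gt0.
  by rewrite !expnS; lia.
move: (trunc_log 10 m).+1 => t.
rewrite [LHS]/mkseq /= (iotaDl 1 0 t : iota 1 t = _) -map_comp divn1; congr (_ :: _).
  by lia.
apply: eq_map => i /=.
rewrite add1n expnS divnMA; congr (_ %/ _ %% _); lia.
Qed.

(** A nonzero leading digit is what makes a digit string recoverable from its
    value. *)
Lemma of_digitsK s :
  all (fun x => x < 10) s -> 0 < last 0 s -> digits (of_digits s) = s.
Proof.
elim: s => [|x [|y s] IHs] //= /andP[x_lt10 s_lt10] s_gt0.
  rewrite of_digits_cons of_digits_nil addn0 /digits.
  by rewrite (@trunc_log_eq 10 0) ?s_gt0 // /mkseq /= divn1 modn_small.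
rewrite of_digits_cons digits_cons //; first by rewrite IHs.
rewrite lt0n; apply/eqP => ys0.
by have := IHs s_lt10 s_gt0; rewrite ys0 => -[y0 s0]; move: s_gt0; rewrite -y0 -s0.
Qed.

Lemma digits_lt10 n : all (fun x => x < 10) (digits n).
Proof. by apply/allP => x /mapP[i _ ->]; rewrite ltn_mod. Qed.

Lemma last_digits_gt0 n : 0 < n -> 0 < last 0 (digits n).
Proof.
move=> n_gt0; rewrite -nth_last size_mkseq nth_mkseq //=.
have /andP[le_n lt_n] := @trunc_log_bounds 10 n isT n_gt0.
by rewrite modn_small ?divn_gt0 ?expn_gt0 // ltn_divLR ?expn_gt0 // -expnS.
Qed.

Lemma digits_mul_rho n c : 0 < n -> 0 < c ->
  digits (n * rho c (size (digits n))) = flatten (nseq c (digits n)).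
Proof.
move=> n_gt0 c_gt0; rewrite -{1}(digitsK n) -of_digits_repeat of_digitsK //.
  by apply/allP => x /flattenP[s /nseqP[-> _]]; exact: (allP (digits_lt10 n)).
case: c c_gt0 => // c _.
have -> : flatten (nseq c.+1 (digits n)) = flatten (nseq c (digits n)) ++ digits n.
  by rewrite -addn1 nseqD flatten_cat /= cats0.
rewrite last_cat; have := last_digits_gt0 n n_gt0.
by case: (digits n).
Qed.

Lemma digit_rev_mul_rho n c : 0 < n -> 0 < c ->
  digit_rev (n * rho c (size (digits n)))
  = digit_rev n * rho c (size (digits n)).
Proof.
move=> n_gt0 c_gt0.
by rewrite /digit_rev digits_mul_rho // rev_repeat of_digits_repeat size_rev.
Qed.

Lemma digit_rev_gt0 n : 0 < n -> 0 < digit_rev n.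
Proof.
move=> /last_digits_gt0; rewrite /digit_rev.
case/lastP: (digits n) => // s x.
by rewrite last_rcons rev_rcons of_digits_cons addn_gt0 => ->.
Qed.

(** * Periodicity of divisibility of rho *)

Lemma rhoD a b k : rho (a + b) k = rho a k + 10 ^ (k * a) * rho b k.
Proof.
elim: a => [|a IHa]; first by rewrite muln0 mul1n /rho [in RHS]big_geq.
by rewrite addSn !rhoS IHa mulnDr addnA mulnA -expnD mulnS.
Qed.

Lemma coprime_rho c k : 0 < c -> 0 < k -> coprime (rho c k) 10.
Proof.
case: c k => // c [//|k] _ _.
by rewrite rhoS expnS -mulnA addnC mulnC /coprime gcdnC gcdnMDl.
Qed.

(** Euler's theorem gives [10 ^ totient d = 1] modulo [d], so the sum [rho] is
    additive over blocks of [totient d] terms, and [d] such blocks sum to 0. *)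
Lemma dvdn_rho_totient d k : coprime 10 d -> d %| rho (totient d * d) k.
Proof.
move=> co_10d.
have pow1 : 10 ^ (k * totient d) = 1 %[mod d].
  by rewrite mulnC expnM -modnXm (@Euler_exp_totient _ _ co_10d) modnXm exp1n.
have blocks j : rho (totient d * j) k = j * rho (totient d) k %[mod d].
  elim: j => [|j IHj]; first by rewrite muln0 /rho big_geq.
  by rewrite mulnS rhoD mulSn -modnDmr -modnMm IHj pow1 modnMm mul1n modnDmr.
by rewrite /dvdn blocks modnMr.
Qed.

(** When [d] is prime to 10, shifting [c] by a multiple of [totient d * d]
    changes [rho c k] by a multiple of [d]; otherwise [d] divides no [rho c k]
    at all. *)
Lemma dvdn_rho_periodic d k w c : 0 < k -> 0 < c -> totient d * d %| w ->
  (d %| rho (c + w) k) = (d %| rho c k).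
Proof.
move=> k_gt0 c_gt0 /dvdnP[q ->].
have [co_10d|nco_10d] := boolP (coprime 10 d).
  suff d_dvd : d %| rho (q * (totient d * d)) k.
    by rewrite rhoD dvdn_addl // dvdn_mull.
  elim: q => [|q IHq]; first by rewrite /rho big_geq.
  by rewrite mulSn rhoD dvdn_add ?dvdn_rho_totient // dvdn_mull.
have ndvd c' : 0 < c' -> (d %| rho c' k) = false.
  move=> c'_gt0; apply: contraNF nco_10d => d_dvd.
  by rewrite coprime_sym (coprime_dvdl d_dvd) ?coprime_rho.
by rewrite !ndvd // addn_gt0 c_gt0.
Qed.

(** * Contributions of the primes to v *)

(** The contribution to [v] of a prime [p] of exponent [e]; the value 0 at
    [e = 0] allows sums over more primes than those of the argument of [v]. *)
Definition v_term p e := if e is e'.+1 then if e == 1 then p else p + e else 0.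

Lemma v_term_exchange p a b e e' : minn e 2 = minn e' 2 ->
  v_term p (a + e) + v_term p (b + e') = v_term p (a + e') + v_term p (b + e).
Proof.
case: e => [|[|e]]; case: e' => [|[|e']]; rewrite ?minnSS ?minn0 //= => _.
by rewrite !addnS /=; lia.
Qed.

Lemma v_sum_superset s n : uniq s -> {subset primes n <= s} ->
  v n = \sum_(p <- s) v_term p (logn p n).
Proof.
move=> uniq_s sub_s.
rewrite (bigID (mem (primes n))) /= [X in _ + X]big1_seq ?addn0; last first.
  by move=> p /andP[]; rewrite -logn_gt0 lt0n negbK => /eqP ->.
rewrite -big_filter /v.
have perm_s : perm_eq (primes n) [seq p <- s | p \in primes n].
  apply: uniq_perm; rewrite ?filter_uniq ?primes_uniq // => p.
  by rewrite mem_filter andb_idr // => /sub_s.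
rewrite -(perm_big _ perm_s); apply: eq_big_seq => p.
by rewrite -logn_gt0; case: (logn p n).
Qed.

(** Among the divisors [x] of a fixed [N], only the sum over the primes of [N]
    depends on [x]; the other sum cancels when two divisors are compared. *)
Lemma v_mul_divisor N x r : 0 < N -> 0 < r -> x %| N ->
  v (x * r) = \sum_(p <- primes N) v_term p (logn p x + logn p r)
    + \sum_(p <- primes r | p \notin primes N) v_term p (logn p r).
Proof.
move=> N_gt0 r_gt0 x_dvd; have x_gt0 := dvdn_gt0 N_gt0 x_dvd.
have sub_xN p : p \in primes x -> p \in primes N.
  by rewrite !mem_primes N_gt0 => /and3P[-> _ /dvdn_trans ->].
rewrite (@v_sum_superset (primes N ++ [seq p <- primes r | p \notin primes N])).
- rewrite big_cat /= big_filter; congr (_ + _).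
    by apply: eq_bigr => p _; rewrite lognM.
  apply: eq_bigr => p p_notin; rewrite lognM // (_ : logn p x = 0) //.
  by apply/eqP; rewrite -leqn0 leqNgt logn_gt0; apply: contra p_notin => /sub_xN.
- rewrite cat_uniq filter_uniq ?primes_uniq //= andbT.
  by apply/hasPn => p; rewrite mem_filter => /andP[].
move=> p; rewrite primesM // mem_cat mem_filter => /orP[/sub_xN ->|->] //.
by rewrite andbT orbN.
Qed.

Lemma minn_logn2 p r : prime p -> 0 < r ->
  minn (logn p r) 2 = (p %| r) + (p ^ 2 %| r).
Proof.
move=> p_pr r_gt0; rewrite -[in p %| r](expn1 p).
rewrite !pfactor_dvdn //.
by case: (logn p r) => [|[|e]] //; rewrite !minnSS minn0.
Qed.

(** Summing [v_term_exchange] over the primes of [n * m] shows that, as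
    integers, [v (n * r) - v (m * r)] and [v (n * r') - v (m * r')] are equal;
    so one vanishes when the other does. *)
Lemma v_mul_eq_iff n m r r' : 0 < n -> 0 < m -> 0 < r -> 0 < r' ->
    {in primes (n * m), forall p, minn (logn p r) 2 = minn (logn p r') 2} ->
  (v (n * r) == v (m * r)) = (v (n * r') == v (m * r')).
Proof.
move=> n_gt0 m_gt0 r_gt0 r'_gt0 same_logn.
have N_gt0 : 0 < n * m by rewrite muln_gt0 n_gt0.
have [n_dvd m_dvd] := (dvdn_mulr m (dvdnn n), dvdn_mull n (dvdnn m)).
rewrite !(@v_mul_divisor (n * m)) // !eqn_add2r.
set A := fun x y => \sum_(p <- primes (n * m)) v_term p (logn p x + logn p y).
rewrite -/(A n r) -/(A m r) -/(A n r') -/(A m r').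
suff : A n r + A m r' = A n r' + A m r by clearbody A; lia.
rewrite /A -!big_split; apply: eq_big_seq => p /same_logn.
exact: v_term_exchange.
Qed.

Lemma v_palindromic_mul_rho n c :
    0 < n -> 0 < c -> ~~ (10 %| n) -> n <> digit_rev n ->
  v_palindromic (n * rho c (size (digits n)))
  = (v (n * rho c (size (digits n))) == v (digit_rev n * rho c (size (digits n)))).
Proof.
move=> n_gt0 c_gt0 n_ndvd10 n_nonpal.
have co_rho : coprime 10 (rho c (size (digits n))).
  by rewrite coprime_sym coprime_rho ?size_mkseq.
have rho_gt0 : 0 < rho c (size (digits n)).
  by case: (rho _ _) co_rho.
rewrite /v_palindromic digit_rev_mul_rho // muln_gt0 n_gt0 rho_gt0 /=.
by rewrite Gauss_dvdl // n_ndvd10 eqn_pmul2r // (introN eqP n_nonpal).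
Qed.

Theorem theorem3p1 (n k : nat) (n_gt0 : 0 < n) (size_n : size (digits n) = k)
    (n_ndvd10 : ~~ (10 %| n)) (n_nonpal : n <> digit_rev n) :
  exists omega : nat, 0 < omega /\
    forall c : nat, 1 <= c ->
      (v_palindromic (n * rho c k) <-> v_palindromic (n * rho (c + omega) k)).
Proof.
set m := digit_rev n; have m_gt0 : 0 < m by exact: digit_rev_gt0.
have k_gt0 : 0 < k by rewrite -size_n size_mkseq.
have rho_gt0 c : 0 < c -> 0 < rho c k by case: c => // c _; rewrite rhoS.
pose per d := totient d * d.
exists (\prod_(p <- primes (n * m)) (per p * per (p ^ 2))); split=> [|c c_gt0].
  rewrite big_seq; apply: prodn_cond_gt0 => p; rewrite mem_primes.
  by move=> /and3P[/prime_gt0 p_gt0 _ _]; rewrite !muln_gt0 !totient_gt0 expn_gt0 p_gt0.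
set w := \prod_(_ <- _) _.
have cw_gt0 : 0 < c + w by rewrite addn_gt0 c_gt0.
rewrite -size_n !v_palindromic_mul_rho // size_n.
rewrite (@v_mul_eq_iff n m _ (rho (c + w) k)) ?rho_gt0 // => p p_in.
have p_pr : prime p by move: p_in; rewrite mem_primes => /andP[].
have per_dvd : per p * per (p ^ 2) %| w by rewrite /w (big_rem p) //= dvdn_mulr.
rewrite !minn_logn2 ?rho_gt0 //.
congr (nat_of_bool _ + nat_of_bool _); symmetry; apply: dvdn_rho_periodic => //.
- exact: dvdn_trans (dvdn_mulr _ (dvdnn _)) per_dvd.
- exact: dvdn_trans (dvdn_mull _ (dvdnn _)) per_dvd.
Qed.
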